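(* Let the predicted multi-target density $\pi_{k+1|k}(\cdot|Z_k)$ be that of a Poisson random finite set on $\mathbb{R}^4$ with intensity function $v_{k+1|k}$, and let the array of amplitude measurements $Z_{k+1}$ have the separable multi-target likelihood $g(Z_{k+1}|X)=g(Z_{k+1}|\mathcal{H}_0)\prod_{x\in X}\mathbb{L}(Z_{k+1}|x)$ for finite sets $X\subset\mathbb{R}^4$, where $\mathbb{L}$ is the single-target likelihood ratio. Then the updated (posterior) intensity function $$v_{k+1}(x)=\frac{\int g(Z_{k+1}|\{x\}\cup W)\,\pi_{k+1|k}(\{x\}\cup W|Z_k)\,\delta W}{\int g(Z_{k+1}|X)\,\pi_{k+1|k}(X|Z_k)\,\delta X}$$ is given by $$v_{k+1}(x)=\mathbb{L}(Z_{k+1}|x)\cdot v_{k+1|k}(x).$$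
   Context: Set integral: for a real-valued function $f$ of finite subsets of $\mathbb{R}^4$, $\int f(X)\,\delta X=\sum_{n=0}^\infty \frac{1}{n!}\int_{(\mathbb{R}^4)^n} f(\{x_1,\dots,x_n\})\,dx_1\cdots dx_n$, the $n=0$ term being $f(\emptyset)$. Poisson random finite set: its multi-target density is $\pi(\{x_1,\dots,x_n\})=\rho(n)\,n!\,\prod_{i=1}^n\pi(x_i)$, where $\rho(n)=e^{-\lambda}\lambda^n/n!$ with $0<\lambda<\infty$ is the cardinality distribution and $\pi(x)$ is a single-target probability density on $\mathbb{R}^4$. Its intensity function is $v(x)=\lambda\pi(x)$, so $\lambda=\int v(x)\,dx$. Here $v=v_{k+1|k}$. Measurement model (amplitude echo model): there are $m$ pixels and the measurement $Z_{k+1}$ supplies an amplitude $A_{k+1}^{(i)}$ for each pixel $i=1,\dots,m$. For a target state $x\in\mathbb{R}^4$, $T(x)\subseteq\{1,\dots,m\}$ is the set of pixels illuminated by $x$. The likelihood of the amplitude in pixel $i$ is $g(A_{k+1}^{(i)}|x,\mathcal{H}_1)$ if the pixel is illuminated by $x$, and $g(A_{k+1}^{(i)}|\mathcal{H}_0)$ (assumed positive) if it is not illuminated by a target. The likelihood ratio of target $x$ is $$\mathbb{L}(Z_{k+1}|x)=\prod_{i\in T(x)}\frac{g(A_{k+1}^{(i)}|x,\mathcal{H}_1)}{g(A_{k+1}^{(i)}|\mathcal{H}_0)},$$ and the noise-only likelihood is $g(Z_{k+1}|\mathcal{H}_0)=\prod_{i=1}^m g(A_{k+1}^{(i)}|\mathcal{H}_0)$.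 Separable likelihood: pixel amplitudes are conditionally independent given the targets and distinct targets are assumed to illuminate disjoint sets of pixels, so the multi-target likelihood is $$g(Z_{k+1}|X)=\Big(\prod_{x\in X}\prod_{i\in T(x)}g(A_{k+1}^{(i)}|x,\mathcal{H}_1)\Big)\Big(\prod_{i\notin\bigcup_{x\in X}T(x)}g(A_{k+1}^{(i)}|\mathcal{H}_0)\Big)=g(Z_{k+1}|\mathcal{H}_0)\prod_{x\in X}\mathbb{L}(Z_{k+1}|x).$$ The final product form is taken as the multi-target likelihood for all finite sets $X$ (including $g(Z_{k+1}|\emptyset)=g(Z_{k+1}|\mathcal{H}_0)$). All functions are measurable and nonnegative, and the Bayes update is assumed well defined, i.e. $\int \mathbb{L}(Z_{k+1}|x)\,v_{k+1|k}(x)\,dx<\infty$. *)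

(* Defs.v *)
From HB Require Import structures.
From mathcomp Require Import all_boot all_order all_algebra finmap.
From mathcomp Require Import all_classical all_reals all_analysis.

Set Implicit Arguments.
Unset Strict Implicit.
Unset Printing Implicit Defensive.

Import Order.TTheory GRing.Theory Num.Theory.
Import numFieldNormedType.Exports.

Local Open Scope classical_set_scope.
Local Open Scope ring_scope.

Section power_measure.
Context {d : measure_display} {T : measurableType d} {R : realType}.

Definition tuple_cons n (p : T * n.-tuple T) : n.+1.-tuple T :=
  [tuple of p.1 :: p.2].

Lemma measurable_tuple_cons n : measurable_fun setT (@tuple_cons n).
Proof. exact: (measurable_cons measurable_fst measurable_snd). Qed.

Variable mu : {sigma_finite_measure set T -> \bar R}.

Section cons.
Variables (n : nat) (nu : {sigma_finite_measure set (n.-tuple T) -> \bar R}).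

Definition cons_measure : set (n.+1.-tuple T) -> \bar R :=
  pushforward (mu \x nu)%E (@tuple_cons n).

Let cm0 : cons_measure set0 = 0%E.
Proof. by rewrite /cons_measure /pushforward preimage_set0 measure0. Qed.

Let cm_ge0 A : (0 <= cons_measure A)%E.
Proof. exact: (@measure_ge0 _ _ _ (mu \x nu)%E). Qed.

Let preimage_cons A : measurable A -> measurable (@tuple_cons n @^-1` A).
Proof.
by move=> mA; rewrite -[X in measurable X]setTI; exact: measurable_tuple_cons.
Qed.

Let cm_sigma_additive : semi_sigma_additive cons_measure.
Proof.
move=> F mF tF mUF; rewrite /cons_measure /pushforward preimage_bigcup.
apply: (@measure_semi_sigma_additive _ _ _ (mu \x nu)%E).
- by move=> k; exact: preimage_cons.
- apply/trivIsetP => /= i j _ _ ij; rewrite -preimage_setI.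
  by move/trivIsetP : tF => /(_ _ _ _ _ ij) ->//; rewrite preimage_set0.
- by rewrite -preimage_bigcup; exact: preimage_cons.
Qed.

HB.instance Definition _ :=
  isMeasure.Build _ _ _ cons_measure cm0 cm_ge0 cm_sigma_additive.

Let cm_sigma_finite : sigma_finite setT cons_measure.
Proof.
have /sigma_finiteP[F [FT ndF Foo]] := sigma_finiteT mu.
have /sigma_finiteP[G [GT ndG Goo]] := sigma_finiteT nu.
pose u (t : n.+1.-tuple T) : T * n.-tuple T := (tnth t ord0, [tuple of behead t]).
have uK (p : T * n.-tuple T) : u (tuple_cons p) = p.
  by case: p => x t; congr pair; exact/val_inj.
exists (fun k => u @^-1` (F k `*` G k)) => [|k].
  apply/esym; rewrite -subTset => t _.
  have [i _ Fi] : (\bigcup_k F k) (u t).1 by rewrite -FT.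
  have [j _ Gj] : (\bigcup_k G k) (u t).2 by rewrite -GT.
  exists (maxn i j) => //; split.
    by move: Fi; exact/subsetPset/ndF/leq_maxl.
  by move: Gj; exact/subsetPset/ndG/leq_maxr.
have [mFk Fkoo] := Foo k; have [mGk Gkoo] := Goo k; split.
  rewrite -[X in measurable X]setTI; apply: measurable_fun_pair => //.
  - exact: measurable_tnth.
  - exact: measurable_behead.
  - exact: measurableX.
rewrite /cons_measure /pushforward (_ : _ @^-1` _ = F k `*` G k).
  by rewrite product_measure1E// lte_mul_pinfty// ge0_fin_numE.
by apply/seteqP; split => p; rewrite /preimage /mkset uK.
Qed.

HB.instance Definition _ :=
  Measure_isSigmaFinite.Build _ _ _ cons_measure cm_sigma_finite.

End cons.

(* The n-fold product of [mu] with itself on T^n, by recursion on n. *)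
Fixpoint power_measure n : {sigma_finite_measure set (n.-tuple T) -> \bar R} :=
  if n is k.+1 then cons_measure (power_measure k) else dirac [tuple].

End power_measure.

Section set_integral.
Context {d : measure_display} {T : measurableType d} {R : realType}.
Variable mu : {sigma_finite_measure set T -> \bar R}.
Implicit Types (f pi g : {fset T} -> R) (p v : T -> R).

(* {x_1, ..., x_n} has fewer than n elements when the x_i are not distinct. *)
Definition set_integral f : \bar R :=
  (\sum_(0 <= n <oo) (n`!%:R^-1)%:E *
     \int[power_measure mu n]_t (f [fset x in tval t]%fset)%:E)%E.

Definition is_density p : Prop :=
  [/\ measurable_fun setT p, forall x, 0 <= p x &
      (\int[mu]_x (p x)%:E = 1)%E].

Definition poisson_density (lambda : R) p (X : {fset T}) : R :=
  poisson_pmf lambda #|` X| * (#|` X|)`!%:R * \prod_(x <- X) p x.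

Definition is_poisson_with_intensity v pi : Prop :=
  exists (lambda : R) p, [/\ 0 < lambda, is_density p,
    forall x, v x = lambda * p x & forall X, pi X = poisson_density lambda p X].

(* The junk values 0^-1 = +oo and +oo^-1 = 0 of the division of extended reals
   do not come into play when the denominator is positive and finite; [g] is the multi-target likelihood of the
   received measurement and [pi] the predicted multi-target density. *)
Definition posterior_intensity g pi (x : T) : \bar R :=
  (set_integral (fun W => (g (x |` W)%fset * pi (x |` W)%fset)%R)
   / set_integral (fun X => (g X * pi X)%R))%E.

End set_integral.

Section measurement.
Context {R : realType} {T : choiceType} {m : nat}.
(* [illum x] is the set of pixels illuminated by [x]; [g1 i a x] and [g0 i a]
   are the likelihoods g(a | x, H_1) and g(a | H_0) of the amplitude [a] in
   pixel [i]; [Z i] is the measured amplitude in pixel [i]. *)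
Variables (illum : T -> {set 'I_m}) (g1 : 'I_m -> R -> T -> R)
  (g0 : 'I_m -> R -> R) (Z : 'I_m -> R).

Definition likelihood_ratio (x : T) : R :=
  \prod_(i in illum x) (g1 i (Z i) x / g0 i (Z i)).

Definition noise_likelihood : R := \prod_(i < m) g0 i (Z i).

Definition multi_target_likelihood (X : {fset T}) : R :=
  noise_likelihood * \prod_(x <- X) likelihood_ratio x.

End measurement.

(* R^4 with its Borel sigma-algebra and Lebesgue measure; [measurableTypeR R]
   is the copy of [R] on which [lebesgue_measure] is defined. *)
Notation R4 R := (4.-tuple (measurableTypeR R)).

Definition lebesgue_measure4 {R : realType} :
    {sigma_finite_measure set (R4 R) -> \bar R} :=
  power_measure lebesgue_measure 4.

(* Main.v *)
(** By separability the joint density is g(Z|X) pi(X) = C prod_(x in X) q(x), where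
    q = L v and C = g(Z|H_0) e^(-lambda) > 0.  Lebesgue measure has no atoms, so
    almost every n-tuple has distinct entries; hence by Tonelli the denominator
    is C sum_n (int q)^n / n! = C e^(int q), which is positive and finite.  For
    the same reason x lies outside almost every W, so the numerator is q(x)
    times the denominator. *)

Require Import Defs.
From HB Require Import structures.
From mathcomp Require Import all_boot all_order all_algebra finmap.
From mathcomp Require Import all_classical all_reals all_analysis.
From mathcomp Require Import measurable_realfun ring.

Set Implicit Arguments.
Unset Strict Implicit.
Unset Printing Implicit Defensive.

Import Order.TTheory GRing.Theory Num.Theory.
Import numFieldNormedType.Exports.

Local Open Scope classical_set_scope.
Local Open Scope ring_scope.

(** A repeated entry counts once in the set. With [undup] the product becomes a function of the
    tuple that can be analysed by recursion on its length. *)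
Lemma big_fset_undup (K : choiceType) (R : comPzSemiRingType) (q : K -> R)
    (s : seq K) :
  \prod_(x <- [fset x in s]%fset) q x = \prod_(x <- undup s) q x.
Proof.
apply: perm_big; apply: uniq_perm; rewrite ?fset_uniq ?undup_uniq//.
by move=> x; rewrite mem_undup in_fset.
Qed.

Lemma measurable_set_pred d (S : measurableType d) (p : pred S) :
  measurable_fun setT p -> measurable [set x | p x].
Proof.
move=> mp; have := mp measurableT [set true] I.
by rewrite setTI; congr measurable.
Qed.

Lemma measurable_prod_tuple d (T : measurableType d) (R : realType) n
    (q : T -> R) : measurable_fun setT q ->
  measurable_fun setT (fun t : n.-tuple T => \prod_(x <- tval t) q x).
Proof.
move=> mq; under eq_fun do rewrite big_tuple.
apply: measurable_prod => i _; apply: measurableT_comp => //.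
exact: measurable_tnth.
Qed.

(** * Tonelli's theorem for the power measure *)

Section power_measure_theory.
Context {d : measure_display} {T : measurableType d} {R : realType}.
Context (mu : {sigma_finite_measure set T -> \bar R}).

Lemma power_measureSE n (A : set (n.+1.-tuple T)) :
  power_measure mu n.+1 A =
  (mu \x power_measure mu n)%E (@tuple_cons _ T n @^-1` A).
Proof. by []. Qed.

(** Change of variables along [tuple_cons], then Tonelli. *)
Lemma ge0_integral_power_measureS n (f : n.+1.-tuple T -> \bar R) :
  measurable_fun setT f -> (forall t, (0 <= f t)%E) ->
  (\int[power_measure mu n.+1]_t f t =
   \int[mu]_x \int[power_measure mu n]_t f (tuple_cons (x, t)))%E.
Proof.
move=> mf f0.
transitivity (\int[mu \x power_measure mu n]_p f (tuple_cons p))%E.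
  rewrite [LHS](ge0_integral_pushforward (@measurable_tuple_cons _ T n))//.
rewrite fubini_tonelli1//.
by apply: measurableT_comp => //; exact: measurable_tuple_cons.
Qed.

Lemma ge0_integral_power_measure_prod n (q : T -> R) :
  measurable_fun setT q -> (forall x, 0 <= q x) ->
  (\int[power_measure mu n]_t (\prod_(x <- tval t) q x)%:E =
   (\int[mu]_x (q x)%:E) ^+ n)%E.
Proof.
move=> mq q0; have mprod k : measurable_fun setT
    (fun t : k.-tuple T => (\prod_(x <- tval t) q x)%:E).
  by apply/measurable_EFinP; exact: measurable_prod_tuple.
have prod0 (s : seq T) : (0 <= (\prod_(x <- s) q x)%:E)%E.
  by rewrite lee_fin prodr_ge0.
elim: n => [|n IHn].
  rewrite (integral_dirac _ _ (mprod 0%N))//.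
  by rewrite diracE in_setT mul1e expe0 big_nil.
rewrite ge0_integral_power_measureS//.
under eq_integral => x _.
  under eq_integral do rewrite big_cons/= EFinM.
  rewrite ge0_integralZl//; [|exact: (mprod n)|by rewrite lee_fin].
  rewrite IHn; over.
rewrite ge0_integralZr//; first by rewrite expeS.
- exact/measurable_EFinP.
- by move=> x _; rewrite lee_fin.
- by rewrite expe_ge0// integral_ge0// => x _; rewrite lee_fin.
Qed.

End power_measure_theory.

(* The library compares integrals of almost everywhere equal functions only when
   both are measurable; a measurable diagonal makes functions of the set
   {x_1, ..., x_n} measurable in the tuple (x_1, ..., x_n). *)
Section diagonal.
Context {d : measure_display} {T : measurableType d} {R : realType}.
Context (mdiag : measurable [set p : T * T | p.1 = p.2]).

Lemma measurable_fun_eq_diag d' (S : measurableType d') (f g : S -> T) :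
  measurable_fun setT f -> measurable_fun setT g ->
  measurable_fun setT (fun x => f x == g x).
Proof.
move=> mf mg; apply: (@measurable_fun_bool _ _ _ _ true).
rewrite (_ : _ @^-1` _ = (fun x => (f x, g x)) @^-1` [set p | p.1 = p.2]).
  exact: (measurable_fun_pair mf mg).
by apply/seteqP; split => x /= /eqP.
Qed.

(** A singleton is a section of the diagonal. *)
Lemma measurable_set1_diag (x : T) : measurable [set x].
Proof.
have : measurable_fun setT (fun y : T => y == x).
  apply: measurable_fun_eq_diag; last exact: measurable_cst.
  exact: measurable_id.
move=> /(_ measurableT [set true] I); rewrite setTI.
by congr measurable; apply/seteqP; split => y /= /eqP.
Qed.

(** Membership is a finite disjunction of equalities. The tuple is a general function [g], so that
    the induction can pass to its tail. *)
Lemma measurable_fun_mem_tuple d' (S : measurableType d') n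
    (f : S -> T) (g : S -> n.-tuple T) :
  measurable_fun setT f -> measurable_fun setT g ->
  measurable_fun setT (fun x => f x \in g x).
Proof.
move=> mf; elim: n g => [|n IHn] g mg.
  by under eq_fun do rewrite tuple0; exact: measurable_cst.
under eq_fun => x do rewrite (tuple_eta (g x)) inE.
apply: measurable_or.
  apply: measurable_fun_eq_diag => //.
  exact: (measurableT_comp (measurable_tnth ord0) mg).
apply: (IHn (fun x => [tuple of behead (g x)])).
exact: (measurableT_comp (@measurable_behead _ T n) mg).
Qed.

Lemma measurable_fun_uniq n :
  measurable_fun setT (fun t : n.-tuple T => uniq t).
Proof.
elim: n => [|n IHn].
  rewrite (_ : (fun _ => _) = cst true); first exact: measurable_cst.
  by apply/funext => t; rewrite tuple0.
rewrite (_ : (fun _ => _) = (fun t : n.+1.-tuple T =>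
    (thead t \notin behead t) && uniq (behead t))); last first.
  by apply/funext => t; rewrite {1}(tuple_eta t).
apply: measurable_and.
  apply: measurable_neg; apply: measurable_fun_mem_tuple.
    exact: measurable_tnth.
  exact: measurable_behead.
exact: (measurableT_comp IHn (@measurable_behead _ T n)).
Qed.

(** [undup] drops the head exactly when it recurs in the tail, which is a measurable condition. *)
Lemma measurable_fun_prod_undup n (q : T -> R) : measurable_fun setT q ->
  measurable_fun setT (fun t : n.-tuple T => \prod_(x <- undup t) q x).
Proof.
move=> mq; elim: n => [|n IHn].
  rewrite (_ : (fun _ => _) = cst 1); first exact: measurable_cst.
  by apply/funext => t; rewrite tuple0 big_nil.
have mt : measurable_fun setT
    (fun t : n.+1.-tuple T => \prod_(x <- undup (behead t)) q x).
  exact: (measurableT_comp IHn (@measurable_behead _ T n)).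
rewrite (_ : (fun _ => _) = (fun t : n.+1.-tuple T =>
    if thead t \in behead t then \prod_(x <- undup (behead t)) q x
    else q (thead t) * \prod_(x <- undup (behead t)) q x)).
  apply: measurable_fun_ifT => //.
    apply: measurable_fun_mem_tuple; first exact: measurable_tnth.
    exact: measurable_behead.
  apply: measurable_funM => //.
  by apply: measurableT_comp => //; exact: measurable_tnth.
apply/funext => t; rewrite {1}(tuple_eta t)/=.
by case: ifPn => // _; rewrite big_cons.
Qed.

(** * Set integrals of products for a measure without atoms *)

Section atomless.
Context (mu : {sigma_finite_measure set T -> \bar R}).
Context (mu1 : forall x, mu [set x] = 0%E).

(** The tuples through [x] form a finite union of hyperplanes on which one coordinate is fixed to
    [x]; each is null because [mu] has no atom at [x]. *)
Lemma power_measure_mem0 n (x : T) :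
  power_measure mu n [set t : n.-tuple T | x \in t] = 0%E.
Proof.
elim: n => [|n IHn].
  rewrite (_ : [set _ | _] = set0) ?measure0// -subset0 => t /=.
  by rewrite tuple0.
have mxt : measurable [set t : n.-tuple T | x \in t].
  by apply: measurable_set_pred; exact: measurable_fun_mem_tuple.
have mx := measurable_set1_diag x.
rewrite power_measureSE.
rewrite (_ : _ @^-1` _ = ([set x] `*` setT) `|`
                         (setT `*` [set t : n.-tuple T | x \in t])).
  rewrite measureU0.
  (* The mass of [setT] may be infinite; the convention that 0 times +oo is 0 covers this case. *)
  - rewrite -[RHS](mul0e (power_measure mu n setT)) -(mu1 x).
    exact: product_measure1E.
  - exact: measurableX.
  - exact: measurableX.
  - by rewrite -[RHS](mule0 (mu setT)) -IHn; exact: product_measure1E.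
apply/seteqP; split => -[y t] /=; rewrite inE.
  by case/orP => [/eqP ->|]; [left|right].
by case=> -[]; [move=> -> _; rewrite eqxx|move=> _ ->; rewrite orbT].
Qed.

(** A repetition either involves the head or lies within the tail. The first case is null section by
    section, the second by induction. *)
Lemma ae_uniq_power_measure n :
  {ae power_measure mu n, forall t : n.-tuple T, uniq t}.
Proof.
have mU k : measurable [set t : k.-tuple T | ~~ uniq t].
  apply: measurable_set_pred; apply: measurable_neg.
  exact: measurable_fun_uniq.
exists [set t : n.-tuple T | ~~ uniq t].
split; [exact: mU| |by move=> t /= /negP].
elim: n => [|n IHn].
  rewrite (_ : [set _ | _] = set0) ?measure0// -subset0 => t /=.
  by rewrite tuple0.
rewrite power_measureSE.
rewrite (_ : _ @^-1` _ = [set p : T * n.-tuple T | p.1 \in p.2] `|`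
                         (setT `*` [set t : n.-tuple T | ~~ uniq t])).
  have mm : measurable [set p : T * n.-tuple T | p.1 \in p.2].
    have := @measurable_fun_mem_tuple _ (T * n.-tuple T)%type n fst snd
      measurable_fst measurable_snd.
    by move=> /(_ measurableT [set true] I); rewrite setTI.
  rewrite measureU0.
  (* The product measure is by definition the integral over [x] of the measures of the sections,
     here the tuples containing [x]. *)
  - apply: integral0_eq => x _.
    rewrite /= (_ : xsection _ _ = [set t : n.-tuple T | x \in t]).
      exact: power_measure_mem0.
    by apply/seteqP; split => t /=; rewrite /xsection/= inE.
  - exact: mm.
  - exact: (measurableX measurableT (mU n)).
  - rewrite -[RHS](mule0 (mu setT)) -IHn.
    exact: (product_measure1E _ _ measurableT (mU n)).
apply/seteqP; split => -[y t] /=; rewrite negb_and negbK.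
  by case/orP; [left|right].
by case=> [->//|[_ ->]]; rewrite orbT.
Qed.

(** For each cardinality, almost every W misses [x], and then [q x] splits off the product. *)
Lemma set_integral_fsetU1 (C : R) (q : T -> R) x :
  measurable_fun setT q -> (forall x, 0 <= q x) -> 0 <= C ->
  set_integral mu (fun W => C * \prod_(y <- (x |` W)%fset) q y) =
  ((q x)%:E * set_integral mu (fun W => (C * \prod_(y <- W) q y)%R))%E.
Proof.
move=> mq q0 C0.
have prod0 (s : seq T) : 0 <= C * \prod_(x <- s) q x.
  by rewrite mulr_ge0// prodr_ge0.
have mprod n : measurable_fun setT
    (fun t : n.-tuple T => (C * \prod_(y <- [fset y in tval t]%fset) q y)%:E).
  apply/measurable_EFinP; apply: measurable_funM => //.
  under eq_fun do rewrite big_fset_undup; exact: measurable_fun_prod_undup.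
rewrite /set_integral -nneseriesZl; last first.
  move=> n _; rewrite mule_ge0 ?lee_fin ?invr_ge0//.
  by apply: integral_ge0 => t _; rewrite lee_fin.
apply: eq_eseriesr => n _; rewrite muleCA; congr (_ * _)%E.
rewrite -ge0_integralZl_EFin//; [|by move=> t _; rewrite lee_fin|exact: mprod].
apply: ae_eq_integral => //.
(* The integrand with [x] adjoined is the one on (n+1)-tuples, restricted to first entry [x]. *)
- under eq_fun do rewrite -fset_cons.
  have mc : measurable_fun setT (fun t : n.-tuple T => tuple_cons (x, t)).
    exact: (measurable_cons (measurable_cst x) (@measurable_id _ _ setT)).
  exact: (measurableT_comp (mprod n.+1) mc).
- by apply: measurable_funeM; exact: mprod.
- have : {ae power_measure mu n, forall t, x \notin tval t}.
    exists [set t : n.-tuple T | x \in t]; split.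
    + by apply: measurable_set_pred; exact: measurable_fun_mem_tuple.
    + exact: power_measure_mem0.
    + by move=> t /= /negP; rewrite negbK.
  apply: filterS => t xt _ /=.
  by rewrite big_fsetU1 ?in_fset//= mulrCA.
Qed.

(** Off the null set of tuples with repetitions, the n-th integrand is a product of functions of
    single coordinates. The n-th term is thus C I^n / n!, with I the integral of [q], and the series
    is exponential. *)
Lemma set_integral_prod (C : R) (q : T -> R) :
  measurable_fun setT q -> (forall x, 0 <= q x) -> 0 <= C ->
  (\int[mu]_x (q x)%:E < +oo)%E ->
  set_integral mu (fun X => C * \prod_(x <- X) q x) =
  (C * expR (fine (\int[mu]_x (q x)%:E)))%:E.
Proof.
move=> mq q0 C0 qoo.
have I0 : (0 <= \int[mu]_x (q x)%:E)%E.
  by apply: integral_ge0 => x _; rewrite lee_fin.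
set I := (\int[mu]_x (q x)%:E)%E in qoo I0 *.
have If : I = (fine I)%:E by rewrite fineK// ge0_fin_numE.
have mprod n : measurable_fun setT
    (fun t : n.-tuple T => (\prod_(y <- undup (tval t)) q y)%:E).
  by apply/measurable_EFinP; exact: measurable_fun_prod_undup.
have mprod' n : measurable_fun setT
    (fun t : n.-tuple T => (\prod_(y <- tval t) q y)%:E).
  by apply/measurable_EFinP; exact: measurable_prod_tuple.
transitivity (\sum_(0 <= n <oo) C%:E * (exp_coeff (fine I) n)%:E)%E.
  apply: eq_eseriesr => n _.
  under eq_integral do rewrite big_fset_undup EFinM.
  rewrite ge0_integralZl_EFin//; [|move=> t _|exact: mprod]; last first.
    by rewrite lee_fin prodr_ge0.
  rewrite (_ : (\int[_]_t _)%E = ((fine I) ^+ n)%:E).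
    by rewrite -!EFinM /exp_coeff/=; congr EFin; ring.
  transitivity (\int[power_measure mu n]_t (\prod_(x <- tval t) q x)%:E)%E.
    apply: ae_eq_integral; [by []|exact: mprod|exact: mprod'|].
    have := ae_uniq_power_measure n.
    by apply: filterS => t ut _ /=; rewrite undup_id.
  by rewrite ge0_integral_power_measure_prod// -/I If EFin_expe.
rewrite nneseriesZl; last first.
  by move=> n _; rewrite lee_fin exp_coeff_ge0// fine_ge0.
(* [expR] is a limit of real partial sums; convergence of the series lets [EFin] commute with that
   limit. *)
rewrite EFinM; congr (_ * _)%E; rewrite /expR -EFin_lim.
  by apply: congr_lim; apply/funext => n /=; rewrite /series/= sumEFin.
exact: is_cvg_series_exp_coeff.
Qed.

Lemma posterior_intensity_prod (C : R) (q : T -> R) (g pi : {fset T} -> R) x :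
  measurable_fun setT q -> (forall x, 0 <= q x) -> 0 < C ->
  (\int[mu]_x (q x)%:E < +oo)%E ->
  (forall X : {fset T}, g X * pi X = C * \prod_(x <- X) q x) ->
  posterior_intensity mu g pi x = (q x)%:E.
Proof.
move=> mq q0 C0 qoo gpi; rewrite /posterior_intensity.
rewrite (funext (fun W => gpi (x |` W)%fset)) (funext gpi).
rewrite set_integral_fsetU1 ?ltW// set_integral_prod ?ltW//.
(* The denominator C e^I is a positive real, so the inverse is the real one and the common factor
   cancels. *)
rewrite inver gt_eqF ?mulr_gt0 ?expR_gt0// -!EFinM mulfK//.
by rewrite gt_eqF// mulr_gt0 ?expR_gt0.
Qed.

End atomless.
End diagonal.

(** * Diagonal, atoms and likelihood ratio on tuples of reals *)

Section R4.
Context {R : realType}.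

(** The diagonal is the finite intersection of the coordinatewise equality sets, each measurable
    because equality of reals is. *)
Lemma measurable_diag_tuple n :
  measurable [set p : n.-tuple (measurableTypeR R) *
                      n.-tuple (measurableTypeR R) | p.1 = p.2].
Proof.
rewrite (_ : [set _ | _] = \big[setI/setT]_(i < n)
    [set p | tnth p.1 i == tnth p.2 i]).
  apply: bigsetI_measurable => i _.
  have : measurable_fun setT (fun p : n.-tuple (measurableTypeR R) *
      n.-tuple (measurableTypeR R) => tnth p.1 i == tnth p.2 i).
    apply: (@measurable_fun_eqr _ _ R).
      exact: (measurableT_comp (measurable_tnth i) measurable_fst).
    exact: (measurableT_comp (measurable_tnth i) measurable_snd).
  by move=> /(_ measurableT [set true] I); rewrite setTI.
rewrite -bigcap_seq; apply/seteqP; split => -[s t] /=.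
  by move=> -> i _ /=.
move=> st; apply/eq_from_tnth => i; apply/eqP/st.
by rewrite /= mem_index_enum.
Qed.

(** A singleton is the product of its head and its tail, and the head is Lebesgue-null. The length
    must be positive: on the empty tuple the measure is a Dirac mass. *)
Lemma power_measure_set1 n (x : n.+1.-tuple (measurableTypeR R)) :
  power_measure (@lebesgue_measure R) n.+1 [set x] = 0%E.
Proof.
have m1 k (y : k.-tuple (measurableTypeR R)) : measurable [set y].
  exact: (measurable_set1_diag (@measurable_diag_tuple k)).
rewrite power_measureSE.
rewrite (_ : _ @^-1` _ = [set thead x] `*` [set [tuple of behead x]]).
  rewrite -[RHS](mul0e (power_measure (@lebesgue_measure R) n
    [set [tuple of behead x]])) -(lebesgue_measure_set1 (thead x)).
  by apply: product_measure1E; [exact: measurable_set1|exact: m1].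
apply/seteqP; split => -[y t] /=.
  by move=> <-; split => //; exact/val_inj.
by case=> -> ->; rewrite [RHS]tuple_eta; exact/val_inj.
Qed.

Lemma measurable_likelihood_ratio (m : nat)
    (illum : R4 R -> {set 'I_m}) (g1 : 'I_m -> R -> R4 R -> R)
    (g0 : 'I_m -> R -> R) (Z : 'I_m -> R) :
  (forall i, measurable [set x | i \in illum x]) ->
  (forall i a, measurable_fun setT (g1 i a)) ->
  measurable_fun setT (likelihood_ratio illum g1 g0 Z).
Proof.
move=> millum mg1; rewrite /likelihood_ratio.
(* The index set depends on [x]; giving unilluminated pixels the factor 1 makes it a fixed product
   over all pixels. *)
under eq_fun do rewrite big_mkcond/=.
apply: measurable_prod => i _; apply: measurable_fun_ifT => //.
  by apply: (@measurable_fun_bool _ _ _ _ true); rewrite setTI; exact: millum.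
exact: measurable_funM.
Qed.

End R4.

Theorem proposition3 (R : realType) (m : nat)
    (illum : R4 R -> {set 'I_m}) (g1 : 'I_m -> R -> R4 R -> R)
    (g0 : 'I_m -> R -> R) (Z : 'I_m -> R)
    (v : R4 R -> R) (pi_pred : {fset R4 R} -> R)
    (illum_measurable : forall i, measurable [set x | i \in illum x])
    (g1_measurable : forall i a, measurable_fun setT (g1 i a))
    (g1_ge0 : forall i a x, 0 <= g1 i a x)
    (g0_gt0 : forall i, 0 < g0 i (Z i))
    (pi_poisson : is_poisson_with_intensity lebesgue_measure4 v pi_pred)
    (update_finite :
      (\int[lebesgue_measure4]_x (likelihood_ratio illum g1 g0 Z x * v x)%:E
       < +oo)%E) :
  forall x : R4 R,
    posterior_intensity lebesgue_measure4
      (multi_target_likelihood illum g1 g0 Z) pi_pred x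
    = (likelihood_ratio illum g1 g0 Z x * v x)%:E.
Proof.
case: pi_poisson => lambda [p [lambda0 [mp p0 _] vE piE]] x.
apply: (@posterior_intensity_prod _ _ _ _ _ _
  (noise_likelihood g0 Z * expR (- lambda))
  (fun x => likelihood_ratio illum g1 g0 Z x * v x)) => //.
- exact: measurable_diag_tuple.
- exact: power_measure_set1.
- apply: measurable_funM; first exact: measurable_likelihood_ratio.
  by rewrite (funext vE); exact: measurable_funM.
- move=> y; rewrite vE !mulr_ge0 ?(ltW lambda0)// prodr_ge0// => i _.
  by rewrite divr_ge0// ltW.
- by rewrite mulr_gt0 ?expR_gt0// prodr_gt0.
- move=> X; rewrite piE /multi_target_likelihood /poisson_density.
  (* Positivity of [lambda] selects the genuine Poisson weight in the definition. *)
  rewrite /poisson_pmf lambda0.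
  under [in RHS]eq_bigr do rewrite vE.
  (* The factor [lambda] of [v], one per point of X, yields the power of [lambda] in the Poisson
     weight; the factorial of the density cancels the one in that weight. *)
  rewrite !big_split/= big_const_seq count_predT iter_mulr_1.
  have X0 : (#|` X|)`!%:R != 0 :> R by rewrite pnatr_eq0 -lt0n fact_gt0.
  by field.
Qed.
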